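(* Let $\mathbf{X}=(X_\lambda,p_{\lambda\lambda'},\Lambda)$ and $\mathbf{Y}=(Y_\mu,q_{\mu\mu'},M)$ be inverse systems in a category $\mathcal{C}$ and let $(f_\mu,\phi),(f'_\mu,\phi'):\mathbf{X}\rightarrow\mathbf{Y}$ be two equivalent morphisms of inverse systems, $(f_\mu,\phi)\sim(f'_\mu,\phi')$. If the morphism $(f_\mu,\phi)$ is uniformly movable, then the morphism $(f'_\mu,\phi')$ is also uniformly movable.
   Context: An inverse system $\mathbf{X}=(X_\lambda,p_{\lambda\lambda'},\Lambda)$ in a category $\mathcal{C}$ consists of a directed preordered set $\Lambda$, objects $X_\lambda$, and morphisms $p_{\lambda\lambda'}:X_{\lambda'}\to X_\lambda$ for $\lambda\le\lambda'$ with $p_{\lambda\lambda}=1$ and $p_{\lambda\lambda'}\circ p_{\lambda'\lambda''}=p_{\lambda\lambda''}$. All index sets are assumed to be cofinite directed sets (each element has only finitely many predecessors). A morphism of inverse systems $(f_\mu,\phi):\mathbf{X}\to\mathbf{Y}$ consists of a function $\phi:M\to\Lambda$ and morphisms $f_\mu:X_{\phi(\mu)}\to Y_\mu$ such that whenever $\mu\le\mu'$ there is $\lambda\ge\phi(\mu),\phi(\mu')$ with $f_\mu\circ p_{\phi(\mu)\lambda}=q_{\mu\mu'}\circ f_{\mu'}\circ p_{\phi(\mu')\lambda}$. For $\lambda\ge\phi(\mu)$ write $f_{\mu\lambda}:=f_\mu\circ p_{\phi(\mu)\lambda}$. Equivalence: $(f_\mu,\phi)\sim(f'_\mu,\phi')$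 if for every $\mu\in M$ there is $\lambda\ge\phi(\mu),\phi'(\mu)$ with $f_\mu\circ p_{\phi(\mu)\lambda}=f'_\mu\circ p_{\phi'(\mu)\lambda}$. An object $A$ of $\mathcal{C}$ is regarded as the (rudimentary) inverse system indexed by a singleton; thus a morphism $\mathbf{u}:A\to\mathbf{Y}$ is a family $u_\mu:A\to Y_\mu$ ($\mu\in M$) with $q_{\mu\mu'}\circ u_{\mu'}=u_\mu$ for $\mu\le\mu'$. For $\mu\in M$, $\mathbf{q}_\mu:\mathbf{Y}\to Y_\mu$ is the morphism given by $1_{Y_\mu}$, so $\mathbf{q}_\mu\circ\mathbf{u}=u_\mu$. Uniformly movable morphism: $(f_\mu,\phi)$ is uniformly movable if every $\mu\in M$ admits $\lambda\in\Lambda$, $\lambda\ge\phi(\mu)$, and a morphism $\mathbf{u}:X_\lambda\to\mathbf{Y}$ with $f_{\mu\lambda}=\mathbf{q}_\mu\circ\mathbf{u}$. *)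

(* Defs.v *)
From Stdlib Require Import List RelationClasses.

Set Implicit Arguments.
Unset Strict Implicit.

Record Category := {
  Ob :> Type;
  Hom : Ob -> Ob -> Type;
  idm : forall A : Ob, Hom A A;
  comp : forall A B D : Ob, Hom B D -> Hom A B -> Hom A D;
  comp_id_l : forall (A B : Ob) (f : Hom A B), comp (idm B) f = f;
  comp_id_r : forall (A B : Ob) (f : Hom A B), comp f (idm A) = f;
  comp_assoc : forall (A B D E : Ob) (h : Hom D E) (g : Hom B D) (f : Hom A B),
      comp h (comp g f) = comp (comp h g) f
}.

Arguments idm {c} A.

Declare Scope cat_scope.
Open Scope cat_scope.
Notation "g \o f" := (comp g f) (at level 40, left associativity) : cat_scope.

Record DirectedSet := {
  carrier :> Type;
  le : carrier -> carrier -> Prop;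
  le_preorder : PreOrder le;
  le_directed : forall a b : carrier, exists c : carrier, le a c /\ le b c;
  le_cofinite : forall a : carrier,
      exists s : list carrier, forall b : carrier, le b a -> In b s
}.

#[global] Existing Instance le_preorder.

Notation "a <=d b" := (le a b) (at level 70, no associativity) : cat_scope.

(* [bond h : X_l' -> X_l] takes a proof [h] of [l <=d l'].  Since [bond_id] and
   [bond_comp] hold for all such proofs, [bond h] does not depend on [h]
   (see [bond_irrelevant]). *)
Record InvSystem (C : Category) := {
  index : DirectedSet;
  term :> index -> C;
  bond : forall l l' : index, l <=d l' -> Hom (term l') (term l);
  bond_id : forall (l : index) (h : l <=d l), bond h = idm (term l);
  bond_comp : forall (l l' l'' : index)
      (h : l <=d l') (h' : l' <=d l'') (h'' : l <=d l''),
      bond h \o bond h' = bond h''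
}.

Lemma bond_irrelevant (C : Category) (X : InvSystem C) (l l' : index X)
  (h h' : l <=d l') : bond h = bond h'.
Proof.
  rewrite <- (bond_comp h (reflexivity l') h'), bond_id.
  symmetry; apply comp_id_r.
Qed.

Record SysMor (C : Category) (X Y : InvSystem C) := {
  idx : index Y -> index X;
  mor : forall m : index Y, Hom (X (idx m)) (Y m);
  mor_coherent : forall (m m' : index Y) (h : m <=d m'),
      exists (l : index X) (h1 : idx m <=d l) (h2 : idx m' <=d l),
        mor m \o bond h1 = bond h \o mor m' \o bond h2
}.

(* The morphism f_{m l}. *)
Definition mor_at (C : Category) (X Y : InvSystem C) (f : SysMor X Y)
  (m : index Y) (l : index X) (h : idx f m <=d l) : Hom (X l) (Y m) :=
  mor f m \o bond h.

Definition sys_equiv (C : Category) (X Y : InvSystem C) (f f' : SysMor X Y) : Prop :=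
  forall m : index Y,
    exists (l : index X) (h : idx f m <=d l) (h' : idx f' m <=d l),
      mor_at h = mor_at h'.

Definition sys_comp (C : Category) (X Y Z : InvSystem C)
  (g : SysMor Y Z) (f : SysMor X Y) : SysMor X Z.
Proof.
  refine {| idx := fun n => idx f (idx g n);
            mor := fun n => mor g n \o mor f (idx g n) |}.
  intros n n' h.
  destruct (mor_coherent g h) as (m & k & k' & E).
  destruct (mor_coherent f k) as (l1 & a1 & b1 & E1).
  destruct (mor_coherent f k') as (l2 & a2 & b2 & E2).
  destruct (le_directed l1 l2) as (l & c1 & c2).
  pose (d := transitivity b1 c1 : idx f m <=d l).
  assert (F1 : mor f (idx g n) \o bond (transitivity a1 c1)
               = bond k \o (mor f m \o bond d)).
  { rewrite <- (bond_comp a1 c1), comp_assoc, E1, <- !comp_assoc.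
    rewrite (bond_comp b1 c1 d); reflexivity. }
  assert (F2 : mor f (idx g n') \o bond (transitivity a2 c2)
               = bond k' \o (mor f m \o bond d)).
  { rewrite <- (bond_comp a2 c2), comp_assoc, E2, <- !comp_assoc.
    rewrite (bond_comp b2 c2 d); reflexivity. }
  exists l, (transitivity a1 c1), (transitivity a2 c2).
  rewrite <- !comp_assoc, F1, F2, (comp_assoc (mor g n)), E.
  rewrite <- !comp_assoc; reflexivity.
Defined.

Definition unit_directed : DirectedSet.
Proof.
  refine {| carrier := unit; le := fun _ _ => True |}.
  - split; red; trivial.
  - intros _ _; exists tt; split; exact I.
  - intros _; exists (tt :: nil); intros [] _; left; reflexivity.
Defined.

Definition rudimentary (C : Category) (A : C) : InvSystem C.
Proof.
  refine {| index := unit_directed;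
            term := fun _ => A;
            bond := fun _ _ _ => idm A |}.
  - reflexivity.
  - intros; apply comp_id_l.
Defined.

(* The morphism q_m : Y -> Y_m. *)
Definition sys_proj (C : Category) (Y : InvSystem C) (m : index Y) :
  SysMor Y (rudimentary (Y m)).
Proof.
  refine (@Build_SysMor C Y (rudimentary (Y m)) (fun _ => m) (fun _ => idm (Y m)) _).
  intros t t' h.
  exists m, (reflexivity m), (reflexivity m).
  simpl; rewrite !comp_id_l; reflexivity.
Defined.

(* Morphisms between rudimentary systems are the morphisms of [C]. *)
Definition rudimentary_mor (C : Category) (A B : C)
  (f : SysMor (rudimentary A) (rudimentary B)) : Hom A B :=
  mor f tt.

Definition uniformly_movable (C : Category) (X Y : InvSystem C) (f : SysMor X Y) : Prop :=
  forall m : index Y,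
    exists (l : index X) (h : idx f m <=d l) (u : SysMor (rudimentary (X l)) Y),
      mor_at h = rudimentary_mor (sys_comp (sys_proj m) u).

(* A morphism [A -> Y] amounts to a family [u_m : A -> Y_m] compatible with the
   bonding morphisms, and its composite with [q_m] is [u_m]. *)
Lemma from_rudimentary_compatible (C : Category) (A : C) (Y : InvSystem C)
  (u : SysMor (rudimentary A) Y) (m m' : index Y) (h : m <=d m') :
  bond h \o mor u m' = mor u m.
Proof.
  destruct (mor_coherent u h) as (l & h1 & h2 & E); simpl in E.
  rewrite !comp_id_r in E; symmetry; exact E.
Qed.

Definition from_rudimentary (C : Category) (A : C) (Y : InvSystem C)
  (u : forall m : index Y, Hom A (Y m))
  (hu : forall (m m' : index Y) (h : m <=d m'), bond h \o u m' = u m) :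
  SysMor (rudimentary A) Y.
Proof.
  refine (@Build_SysMor C (rudimentary A) Y (fun _ => tt) u _).
  intros m m' h; exists tt, I, I; simpl.
  rewrite !comp_id_r; symmetry; apply hu.
Defined.

Lemma sys_proj_comp (C : Category) (A : C) (Y : InvSystem C)
  (u : SysMor (rudimentary A) Y) (m : index Y) :
  rudimentary_mor (sys_comp (sys_proj m) u) = mor u m.
Proof. apply comp_id_l. Qed.

(* Main.v *)
From Stdlib Require Import RelationClasses.
Require Import Defs.

(** If [f] is movable at [m] through [u : X_l -> Y], so that [f_{ml} = q_m o u],
    and [f], [f'] agree at [m] from the stage [k] on, choose a stage [n] above
    both [l] and [k]. The restriction [u o p_{ln} : X_n -> Y] then witnesses
    movability of [f'] at [m], because
    [f'_{mn} = f_{mn} = f_{ml} o p_{ln} = q_m o (u o p_{ln})].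
    Lemma [mor_at_bond] lets both given equations be transported to [n], and
    [restrict_from_rudimentary] supplies the restricted family. *)

Lemma mor_at_bond (C : Category) (X Y : InvSystem C) (f : SysMor X Y)
  (m : index Y) (l n : index X)
  (h : idx f m <=d l) (k : l <=d n) (h' : idx f m <=d n) :
  mor_at h \o bond k = mor_at h'.
Proof.
  unfold mor_at.
  rewrite <- comp_assoc, (bond_comp h k h'); reflexivity.
Qed.

Lemma restrict_from_rudimentary (C : Category) (A B : C) (Y : InvSystem C)
  (u : SysMor (rudimentary A) Y) (g : Hom B A) :
  exists v : SysMor (rudimentary B) Y, forall m : index Y,
    rudimentary_mor (sys_comp (sys_proj m) v)
    = rudimentary_mor (sys_comp (sys_proj m) u) \o g.
Proof.
  assert (hv : forall (m m' : index Y) (h : m <=d m'),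
             bond h \o ((mor u m' : Hom A (Y m')) \o g)
             = (mor u m : Hom A (Y m)) \o g).
  { intros m m' h.
    rewrite comp_assoc.
    exact (f_equal (fun w : Hom A (Y m) => w \o g)
             (from_rudimentary_compatible u h)). }
  exists (from_rudimentary hv); intros m.
  rewrite !sys_proj_comp; reflexivity.
Qed.

Theorem proposition3p11 (C : Category) (X Y : InvSystem C) (f f' : SysMor X Y) :
  sys_equiv f f' -> uniformly_movable f -> uniformly_movable f'.
Proof.
  intros Heq Hum m.
  destruct (Hum m) as (l & hl & u & Hu).
  destruct (Heq m) as (k & hk & hk' & Hk).
  destruct (le_directed l k) as (n & ln & kn).
  destruct (restrict_from_rudimentary _ _ _ _ u (bond ln)) as [v Hv].
  exists n, (transitivity hk' kn), v.
  rewrite Hv, <- Hu, (mor_at_bond _ _ _ _ _ _ _ hl ln (transitivity hk kn)).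
  rewrite <- (mor_at_bond _ _ _ _ _ _ _ hk' kn), <- Hk.
  apply mor_at_bond.
Qed.
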